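(* Let $\mathcal{V}=(\mathcal{V},\otimes,k)$ be a commutative unital quantale which is completely distributive and such that $\{u\in\mathcal{V}\mid u\lll k\}$ is directed. For every $\mathcal{V}$-categorical compact Hausdorff space $X=(X,a,\alpha)$, the set $\mathsf{H}X$ of closed increasing subsets of $X$, equipped with the hit-and-miss topology and the Hausdorff structure $\mathsf{H}a$, is a $\mathcal{V}$-categorical compact Hausdorff space.
   Context: A commutative unital quantale is a complete lattice $\mathcal{V}$ with a commutative monoid structure $(\otimes,k)$ such that each $u\otimes-$ preserves suprema. The totally below relation is: $u\lll v$ iff for every $S\subseteq\mathcal{V}$ with $v\le\bigvee S$ there is $s\in S$ with $u\le s$. $\mathcal{V}$ is completely distributive iff $v=\bigvee\{u\mid u\lll v\}$ for all $v$. A $\mathcal{V}$-category $(X,a)$ is a set $X$ with $a\colon X\times X\to\mathcal{V}$ such that $k\le a(x,x)$ and $a(x,y)\otimes a(y,z)\le a(x,z)$; a $\mathcal{V}$-functor $f\colon(X,a)\to(Y,b)$ is a map with $a(x,y)\le b(f(x),f(y))$. Let $\mathsf{U}$ be the ultrafilter functor on sets; compact Hausdorff topologies on $X$ are identified with their convergence maps $\alpha\colon\mathsf{U}X\to X$ (algebras for the ultrafilter monad). The map $\xi\colon\mathsf{U}\mathcal{V}\to\mathcal{V}$, $\xi(\mathfrak{v})=\bigwedge_{A\in\mathfrak{v}}\bigvee A$, is the convergence of a compact Hausdorff topology on $\mathcal{V}$ (the Lawson topology). For a $\mathcal{V}$-category $(X,a)$ put $\mathsf{U}(X,a)=(\mathsf{U}X,\widehat{\mathsf{U}}a)$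 with $\widehat{\mathsf{U}}a(\mathfrak{x},\mathfrak{y})=\bigvee\{\xi(\mathsf{U}a(\mathfrak{w}))\mid\mathfrak{w}\in\mathsf{U}(X\times X),\ \mathsf{U}\pi_1(\mathfrak{w})=\mathfrak{x},\ \mathsf{U}\pi_2(\mathfrak{w})=\mathfrak{y}\}$. A $\mathcal{V}$-categorical compact Hausdorff space $(X,a,\alpha)$ is a $\mathcal{V}$-category $(X,a)$ together with a compact Hausdorff topology $\alpha$ on $X$ such that $\alpha\colon\mathsf{U}(X,a)\to(X,a)$ is a $\mathcal{V}$-functor; it is known that this is equivalent to continuity of $a\colon(X,\alpha)\times(X,\alpha)\to(\mathcal{V},\xi_\le)$, where $\xi_\le$ is the topology on $\mathcal{V}$ generated by the sets $\{u\in\mathcal{V}\mid v\nleq u\}$ ($v\in\mathcal{V}$). For $A\subseteq X$ put $\uparrow\! A=\{y\mid k\le\bigvee_{x\in A}a(x,y)\}$ and $\downarrow\! A=\{y\mid k\le\bigvee_{x\in A}a(y,x)\}$. $A$ is increasing (decreasing) if $A=\uparrow\! A$ ($A=\downarrow\! A$), and co-increasing (co-decreasing) if its complement is increasing (decreasing). Put $\mathsf{H}X=\{A\subseteq X\mid A\text{ closed and increasing}\}$ with Hausdorff structure $\mathsf{H}a(A,B)=\bigwedge_{y\in B}\bigvee_{x\in A}a(x,y)$. The hit-and-miss topology on $\mathsf{H}X$ is generated by the sets $V^\Diamond=\{A\in\mathsf{H}X\mid A\cap V\neq\varnothing\}$ ($V$ open, co-increasing) and $W^\Box=\{A\in\mathsf{H}X\mid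 A\subseteq W\}$ ($W$ open, co-decreasing). *)

(* Defs.v *)
From HB Require Import structures.
From mathcomp Require Import all_boot all_order.
From mathcomp Require Import boolp classical_sets filter topology.

Set Implicit Arguments.
Unset Strict Implicit.
Unset Printing Implicit Defensive.

Local Open Scope classical_set_scope.
Local Open Scope order_scope.

HB.mixin Record POrder_isQuantale (d : Order.disp_t) V of Order.POrder d V := {
  qsup : set V -> V;
  qunit : V;
  qtens : V -> V -> V;
  qsup_isLub : forall S : set V, isLub S (qsup S);
  qtensA : associative qtens;
  qtensC : commutative qtens;
  qtens1q : left_id qunit qtens;
  qtens_sup : forall (u : V) (S : set V),
    qtens u (qsup S) = qsup [set qtens u s | s in S]
}.

(* Commutative unital quantales. *)
#[short(type="quantaleType")]
HB.structure Definition Quantale d :=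
  {V of Order.POrder d V & POrder_isQuantale d V}.

Definition qinf d (V : quantaleType d) (S : set V) : V := qsup (lbound S).

Lemma qinf_infimums d (V : quantaleType d) (S : set V) : infimums S (qinf S).
Proof.
have [ub lub] := qsup_isLub (lbound S); split => [x Sx|x]; last exact: ub.
by apply: lub => y; apply.
Qed.

Definition totally_below d (V : quantaleType d) (u v : V) :=
  forall S : set V, v <= qsup S -> exists2 s, S s & u <= s.

Definition completely_distributive d (V : quantaleType d) :=
  forall v : V, v = qsup [set u | totally_below u v].

Definition directed d (V : porderType d) (D : set V) :=
  D !=set0 /\
  forall u v, D u -> D v -> exists2 w, D w & u <= w /\ v <= w.

Definition vcategory d (V : quantaleType d) (X : Type) (a : X -> X -> V) :=
  (forall x, qunit <= a x x) /\
  (forall x y z, qtens (a x y) (a y z) <= a x z).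

Definition vfunctor d (V : quantaleType d) (X Y : Type)
    (a : X -> X -> V) (b : Y -> Y -> V) (f : X -> Y) :=
  forall x y, a x y <= b (f x) (f y).

(* The ultrafilter functor. *)
Record ultra (X : Type) := Ultra {
  ultra_sets :> set_system X;
  ultra_filter : UltraFilter ultra_sets
}.

Lemma fmap_ultra (X Y : Type) (f : X -> Y) (F : set_system X) :
  UltraFilter F -> UltraFilter (fmap f F).
Proof.
move=> FU; split; first exact: fmap_proper_filter.
move=> G GF sFG; apply/seteqP; split=> [A GA|]; last exact: sFG.
have [//|FnA] := in_ultra_setVsetC (f @^-1` A) FU.
have GnA : G (~` A) by apply: sFG.
by case: (@filter_not_empty _ G GF); rewrite -(setICr A); exact: filterI.
Qed.

Definition ultra_map (X Y : Type) (f : X -> Y) (F : ultra X) : ultra Y :=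
  Ultra (fmap_ultra f (ultra_filter F)).

Definition xi d (V : quantaleType d) (F : ultra V) : V :=
  qinf [set qsup A | A in (F : set_system V)].

Definition ultra_dist d (V : quantaleType d) (X : Type) (a : X -> X -> V)
    (F G : ultra X) : V :=
  qsup [set xi (ultra_map (fun p : X * X => a p.1 p.2) W) |
    W in [set W : ultra (X * X) | ultra_map fst W = F /\ ultra_map snd W = G]].

(* In a compact Hausdorff space there is exactly one such map, see
   [convergence_map_exists] and [convergence_map_unique]. *)
Definition convergence_map (X : topologicalType) (alpha : ultra X -> X) :=
  forall F : ultra X, ultra_sets F --> alpha F.

Lemma convergence_map_exists (X : topologicalType) :
  compact [set: X] -> exists alpha : ultra X -> X, convergence_map alpha.
Proof.
rewrite compact_ultra => cX.
have cvgF (F : ultra X) : {x : X | ultra_sets F --> x}.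
  apply/cid; have [|x [_ Fx]] := cX F (ultra_filter F); last by exists x.
  by have := ultra_filter F => FU; exact: filterT.
by exists (fun F => sval (cvgF F)) => F; exact: svalP (cvgF F).
Qed.

Lemma convergence_map_unique (X : topologicalType) (alpha beta : ultra X -> X) :
  hausdorff_space X -> convergence_map alpha -> convergence_map beta ->
  alpha = beta.
Proof.
move=> hX ca cb; apply/funext => F; have FU := ultra_filter F.
exact: cvg_unique (ca F) (cb F).
Qed.

(* The topology of X plays the role of its convergence map alpha. *)
Definition vcat_compact_hausdorff d (V : quantaleType d) (X : topologicalType)
    (a : X -> X -> V) :=
  [/\ vcategory a, compact [set: X], hausdorff_space X &
      exists2 alpha : ultra X -> X,
        convergence_map alpha & vfunctor (ultra_dist a) a alpha].

Definition up_closure d (V : quantaleType d) (X : Type) (a : X -> X -> V)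
    (A : set X) : set X :=
  [set y | qunit <= qsup [set a x y | x in A]].

Definition down_closure d (V : quantaleType d) (X : Type) (a : X -> X -> V)
    (A : set X) : set X :=
  [set y | qunit <= qsup [set a y x | x in A]].

Definition increasing d (V : quantaleType d) (X : Type) (a : X -> X -> V)
    (A : set X) := A = up_closure a A.

Definition decreasing d (V : quantaleType d) (X : Type) (a : X -> X -> V)
    (A : set X) := A = down_closure a A.

Definition co_increasing d (V : quantaleType d) (X : Type) (a : X -> X -> V)
    (A : set X) := increasing a (~` A).

Definition co_decreasing d (V : quantaleType d) (X : Type) (a : X -> X -> V)
    (A : set X) := decreasing a (~` A).

Record hyperspace d (V : quantaleType d) (X : topologicalType)
    (a : X -> X -> V) := Hyperspace {
  hyperspace_set :> set X;
  hyperspace_closed : closed hyperspace_set;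
  hyperspace_increasing : increasing a hyperspace_set
}.

Definition hausdorff_dist d (V : quantaleType d) (X : topologicalType)
    (a : X -> X -> V) (A B : hyperspace a) : V :=
  qinf [set qsup [set a x y | x in (A : set X)] | y in (B : set X)].

Arguments hausdorff_dist {d V X} a A B.

Definition hit d (V : quantaleType d) (X : topologicalType)
    (a : X -> X -> V) (U : set X) : set (hyperspace a) :=
  [set A | (A : set X) `&` U !=set0].

Definition miss d (V : quantaleType d) (X : topologicalType)
    (a : X -> X -> V) (W : set X) : set (hyperspace a) :=
  [set A | (A : set X) `<=` W].

Arguments hit {d V X} a U.
Arguments miss {d V X} a W.

Definition hit_and_miss d (V : quantaleType d) (X : topologicalType)
    (a : X -> X -> V) : set (set (hyperspace a)) :=
  [set hit a U | U in [set U | open U /\ co_increasing a U]] `|`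
  [set miss a W | W in [set W | open W /\ co_decreasing a W]].

HB.instance Definition _ d (V : quantaleType d) (X : topologicalType)
  (a : X -> X -> V) := gen_eqMixin (hyperspace a).
HB.instance Definition _ d (V : quantaleType d) (X : topologicalType)
  (a : X -> X -> V) := gen_choiceMixin (hyperspace a).
HB.instance Definition _ d (V : quantaleType d) (X : topologicalType)
  (a : X -> X -> V) :=
  isSubBaseTopological.Build (hyperspace a) (@hit_and_miss d V X a) id.

(* Main.v *)
Require Import Defs.
From mathcomp Require Import all_boot all_order.
From mathcomp Require Import boolp classical_sets filter topology.

(** The idea is to reduce everything to a closed preorder.

    For [v : V] let [level a v] be the relation [v <= a x y].  Functoriality of
    the convergence map makes every [level a v] closed ([closed_level]): an
    ultrafilter on [level a v] converging to [(x, y)] has [xi]-value at least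
    [v], and this value is below [a x y].  The relation at [v = qunit] is a
    preorder on [X].  When [A] is closed, compactness and the directedness of
    the elements totally below the unit show that a supremum of [a x y] over
    [x] in [A] that is above the unit is attained at this level, so that a
    closed set is increasing exactly when it is an up-set of this preorder
    ([closed_increasingP]).  The hyperspace is thus the space of closed up-sets
    of a compact Hausdorff preordered space with closed preorder, where
    Nachbin's separation theorem [nachbin_separation] is at hand: disjoint
    closed up-sets and down-sets have disjoint open neighbourhoods which are
    again an up-set and a down-set.

    Compactness: an ultrafilter [F] on the hyperspace converges to the set of
    the points all of whose open down-set neighbourhoods [U] satisfy
    [F (hit a U)] ([cvg_hyperspace_lim]).

    Hausdorff: if [x] is in [A] but not in [B], Nachbin separation of [B] from
    the down-closure of [x] yields a miss set around [B] disjoint from a hit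
    set around [A] ([hyperspace_sep]).

    Functoriality of the convergence map ([vfunctor_hyperspace]): let the
    ultrafilter [w] of pairs have projections converging to [A] and [B], and
    let [v] be totally below [u], [u] totally below the [xi]-value of [w], and
    [y] in [B].  Then [u <= hausdorff_dist a A' B'] for [w]-almost all
    [(A', B')].  If no [x] in [A] had [v <= a x y], Nachbin separation of [A]
    from the down-set of all such [x] would give neighbourhoods of [A] and [B]
    forcing [~ (v <= a x' y')] for some [y'] in [B'] and all [x'] in [A'],
    which is absurd.  Complete distributivity turns the resulting inequality
    for all such [v] into the one for the [xi]-value. *)

Set Implicit Arguments.
Unset Strict Implicit.
Unset Printing Implicit Defensive.

Import Order.TTheory.
Local Open Scope order_scope.
Local Open Scope classical_set_scope.

(** * Suprema and infima in a quantale *)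

Section QuantaleOrder.
Context d (V : quantaleType d).
Implicit Types (S : set V) (u v w : V).

Lemma qsup_ub S v : S v -> v <= qsup S.
Proof. by move=> Sv; have [ub _] := qsup_isLub S; exact: ub. Qed.

Lemma qsup_le S w : (forall v, S v -> v <= w) -> qsup S <= w.
Proof. by move=> Sw; have [_] := qsup_isLub S; apply. Qed.

Lemma qinf_lb S v : S v -> qinf S <= v.
Proof. by move=> Sv; apply: qsup_le => w; exact. Qed.

Lemma le_qinf S w : (forall v, S v -> w <= v) -> w <= qinf S.
Proof. by move=> wS; exact: qsup_ub. Qed.

Lemma qtens_le2l u v w : v <= w -> qtens u v <= qtens u w.
Proof.
move=> vw; have -> : w = qsup [set v; w].
  apply/le_anti/andP; split; first by apply: qsup_ub; right.
  by apply: qsup_le => _ [] ->.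
by rewrite qtens_sup; apply: qsup_ub; exists v => //; left.
Qed.

Lemma qtens_le2 u v u' v' : u <= u' -> v <= v' -> qtens u v <= qtens u' v'.
Proof.
move=> uu' vv'; apply: le_trans (qtens_le2l u vv') _.
by rewrite !(qtensC _ v'); exact: qtens_le2l.
Qed.

Lemma le_totally_below v w : completely_distributive V ->
  (forall u, totally_below u v -> u <= w) -> v <= w.
Proof. by move=> cdV uw; rewrite (cdV v); exact: qsup_le. Qed.

End QuantaleOrder.

(** * Closed relations on compact Hausdorff spaces *)

Section ClosedRelations.
Context (X : topologicalType).
Hypotheses (cX : compact [set: X]) (hX : hausdorff_space X).

Definition flip_rel (R : set (X * X)) : set (X * X) := [set p | R (p.2, p.1)].

(** Dual statements about down-sets and decreasing sets are obtained by
    applying the up-set versions to the flipped relation. *)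
Lemma closed_flip_rel R : closed R -> closed (flip_rel R).
Proof.
move=> cR; apply: (@preimage_closed _ _ (fun p : X * X => (p.2, p.1))) => //.
move=> p _; apply: cvg_pair; [exact: cvg_snd | exact: cvg_fst].
Qed.

Definition rel_image (R : set (X * X)) (C : set X) : set X :=
  [set y | exists2 x, C x & R (x, y)].

(** The image is the projection of a closed, hence compact, subset of the
    square. *)
Lemma closed_rel_image R C :
  closed R -> closed C -> closed (rel_image R C).
Proof.
move=> cR cC.
have -> : rel_image R C = snd @` (R `&` (fst @^-1` C)).
  apply/seteqP; split=> [y [x Cx Rxy]|y [[x z] [/= Rxz Cx] <-]].
    by exists (x, y).
  by exists x.
apply: compact_closed => //; apply: continuous_compact.
  by apply: continuous_subspaceT => p; exact: cvg_snd.
apply: (@subclosed_compact _ _ [set: X * X]) => //.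
  apply: closedI => //; apply: preimage_closed => // p _; exact: cvg_fst.
by rewrite -setXTT; exact: compact_setX.
Qed.

Lemma normal_separation (A B : set X) : closed A -> closed B ->
  A `&` B = set0 ->
  exists U W, [/\ open U, open W, A `<=` U, B `<=` W & U `&` W = set0].
Proof.
move=> cA cB AB0.
have : set_nbhs A (~` B).
  apply/set_nbhsP; exists (~` B); split=> //; first exact: closed_openC.
  by move=> x Ax Bx; have : (A `&` B) x by []; rewrite AB0.
move=> /(compact_normal hX cX cA)[N /set_nbhsP[U [oU AU UN]] clN].
exists U, (~` closure N); split => //.
- exact/closed_openC/closed_closure.
- by move=> x Bx /clN.
- by apply/seteqP; split=> x // -[/UN/(@subset_closure _ N)].
Qed.

Definition upset (R : set (X * X)) (A : set X) :=
  forall x y, A x -> R (x, y) -> A y.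

Lemma upset_setC R A : upset (flip_rel R) A -> upset R (~` A).
Proof. by move=> uA x y nAx Rxy Ay; apply/nAx/(uA y). Qed.

(** Start from a normal separation and shrink: remove from each neighbourhood
    the down-closure, respectively the up-closure, of its complement.  These
    closures are closed, so what remains is open and monotone, and it still
    contains [A], respectively [B], as these are monotone themselves. *)
Lemma nachbin_separation R (A B : set X) : closed R ->
  (forall x, R (x, x)) -> (forall x y z, R (x, y) -> R (y, z) -> R (x, z)) ->
  closed A -> upset R A -> closed B -> upset (flip_rel R) B ->
  A `&` B = set0 ->
  exists U W, [/\ open U /\ upset R U, open W /\ upset (flip_rel R) W,
    A `<=` U, B `<=` W & U `&` W = set0].
Proof.
move=> cR rR tR cA uA cB dB AB0.
have [U [W [oU oW AU BW UW0]]] := normal_separation cA cB AB0.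
have cR' := closed_flip_rel cR.
exists (~` rel_image (flip_rel R) (~` U)), (~` rel_image R (~` W)); split.
- split; first exact/closed_openC/closed_rel_image/open_closedC.
  apply: upset_setC => x y [z nUz Rxz] Ryx; exists z => //; exact: tR Ryx Rxz.
- split; first exact/closed_openC/closed_rel_image/open_closedC.
  apply: upset_setC => x y [z nUz Rxz] Ryx; exists z => //; exact: tR Ryx.
- by move=> x Ax [z nUz Rxz]; apply/nUz/AU/(uA x).
- by move=> x Bx [z nWz Rxz]; apply/nWz/BW/(dB x).
- apply/seteqP; split=> x // -[nU nW].
  suff : (U `&` W) x by rewrite UW0.
  by split; apply: contrapT => n; [apply: nU|apply: nW]; exists x => //; exact: rR.
Qed.

End ClosedRelations.

(** * The topology induced by a V-category structure *)

Section VCat.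
Context d (V : quantaleType d) (X : topologicalType) (a : X -> X -> V).

Definition level (v : V) : set (X * X) := [set p | v <= a p.1 p.2].

(** This is the continuity of [a] for the topology on [V] whose closed sets are
    generated by the principal up-sets. *)
Lemma closed_level v : vcat_compact_hausdorff a -> closed (level v).
Proof.
move=> [_ _ hX [alpha calpha falpha]] [x y] clxy.
have /ultraFilterLemma[W [WU sW]] := within_nbhs_proper clxy.
have WP : ProperFilter W by exact: ultra_proper.
have Wxy : W --> (x, y) by move=> A Axy; apply: sW; apply: cvg_within Axy.
have Wv : W (level v) by apply: sW; exact: withinT.
pose w := Ultra WU.
have Wx : ultra_sets (ultra_map fst w) --> x.
  exact: cvg_trans (cvg_app fst Wxy) cvg_fst.
have Wy : ultra_sets (ultra_map snd w) --> y.
  exact: cvg_trans (cvg_app snd Wxy) cvg_snd.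
have FX := ultra_filter (ultra_map fst w).
have FY := ultra_filter (ultra_map snd w).
rewrite /level/= -(cvg_unique hX (calpha _) Wx) -(cvg_unique hX (calpha _) Wy).
apply: le_trans (falpha _ _).
apply: (@le_trans _ _ (xi (ultra_map (fun p : X * X => a p.1 p.2) w))).
  apply: le_qinf => _ [S WS <-].
  have [p [vp Sp]] := filter_ex (@filterI _ W _ _ _ Wv WS).
  exact: le_trans vp (qsup_ub Sp).
by apply: qsup_ub; exists w.
Qed.

End VCat.

Section Increasing.
Context d (V : quantaleType d) (X : topologicalType).
Hypothesis cdV : completely_distributive V.
Hypothesis dirV : directed [set u : V | totally_below u qunit].
Hypothesis cX : compact [set: X].

(** For [u] totally below the unit some [x] in [A] has [u <= a x y]; by
    directedness these closed subsets of [A] generate a filter, any cluster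
    point of which works for all [u] at once. *)
Lemma closed_sup_attained (a : X -> X -> V) (A : set X) y :
  (forall v, closed (level a v)) -> closed A ->
  qunit <= qsup [set a x y | x in A] -> exists2 x, A x & qunit <= a x y.
Proof.
move=> cR cA ky; have [ne dir] := dirV.
pose B (u : V) := [set x | A x /\ u <= a x y].
have FF : ProperFilter (filter_from [set u : V | totally_below u qunit] B).
  apply: filter_from_proper; last first.
    by move=> u /(_ _ ky)[_ [x Ax <-] uxy]; exists x.
  apply: filter_from_filter => // u v tu tv.
  have [w tw [uw vw]] := dir _ _ tu tv; exists w => // x [Ax wx].
  by split; split=> //; [exact: le_trans wx|exact: le_trans wx].
have [//|x [_ Fx]] := cX FF; first by exact: filterT.
have Bx u : totally_below u qunit -> B u x.
  move=> tu; have cB : closed (B u).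
    apply: closedI => //.
    apply: (@preimage_closed _ _ (fun x : X => (x, y)) _ _ (cR u)) => z _.
    by apply: cvg_pair; [exact: cvg_id|exact: cvg_cst].
  by apply: cB => N Nx; apply: Fx => //; exists u.
exists x; first by have [u tu] := ne; have [] := Bx u tu.
by apply: le_totally_below => // u /Bx[].
Qed.

(** A closed set that is stable under the pointwise order [qunit <= a x y] is
    stable under the a priori weaker condition on suprema, by
    [closed_sup_attained]. *)
Lemma closed_increasingP (a : X -> X -> V) (A : set X) :
  (forall x, qunit <= a x x) -> (forall v, closed (level a v)) -> closed A ->
  increasing a A <-> upset (level a qunit) A.
Proof.
move=> ka cR cA; split=> [incA x y Ax kxy|uA].
  rewrite incA; apply: le_trans kxy _.
  by apply: qsup_ub; exists x.
apply/seteqP; split=> [x Ax|y /(closed_sup_attained cR cA)[x Ax kxy]].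
  by apply: le_trans (ka x) _; apply: qsup_ub; exists x.
exact: (uA x).
Qed.

Lemma closed_decreasingP (a : X -> X -> V) (A : set X) :
  (forall x, qunit <= a x x) -> (forall v, closed (level a v)) -> closed A ->
  decreasing a A <-> upset (flip_rel (level a qunit)) A.
Proof.
move=> ka cR cA.
apply: (@closed_increasingP (fun x y => a y x)) => // v.
exact: (closed_flip_rel (cR v)).
Qed.

End Increasing.

(** * The hyperspace of closed increasing subsets *)

Section Hyperspace.
Context d (V : quantaleType d) (X : topologicalType) (a : X -> X -> V).
Hypothesis cdV : completely_distributive V.
Hypothesis dirV : directed [set u : V | totally_below u qunit].
Hypothesis aX : vcat_compact_hausdorff a.

Let ka x : qunit <= a x x. Proof. by have [[]] := aX. Qed.
Let ta x y z : qtens (a x y) (a y z) <= a x z. Proof. by have [[]] := aX. Qed.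
Let cX : compact [set: X]. Proof. by have [] := aX. Qed.
Let hX : hausdorff_space X. Proof. by have [] := aX. Qed.
Let cR v : closed (level a v). Proof. exact: closed_level. Qed.

Local Notation R := (level a qunit).

Lemma level_trans u v x y z :
  level a u (x, y) -> level a v (y, z) -> level a (qtens u v) (x, z).
Proof. by move=> ? ?; apply: le_trans (ta x y z); exact: qtens_le2. Qed.

Lemma level_lower v x y z : R (x, y) -> level a v (y, z) -> level a v (x, z).
Proof. by move=> Rxy /(level_trans Rxy); rewrite qtens1q. Qed.

Lemma level_upper v x y z : level a v (x, y) -> R (y, z) -> level a v (x, z).
Proof. by move=> vxy /(level_trans vxy); rewrite qtensC qtens1q. Qed.

Lemma co_increasingP U : open U -> co_increasing a U <-> upset (flip_rel R) U.
Proof.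
move=> oU; have incP := closed_increasingP cdV dirV cX ka cR (open_closedC oU).
split=> [/incP uU|uU]; first by rewrite -(setCK U); exact: upset_setC.
exact/incP/upset_setC.
Qed.

Lemma co_decreasingP U : open U -> co_decreasing a U <-> upset R U.
Proof.
move=> oU; have decP := closed_decreasingP cdV dirV cX ka cR (open_closedC oU).
split=> [/decP uU|uU]; first by rewrite -(setCK U); exact: upset_setC.
exact/decP/upset_setC.
Qed.

Lemma hyperspace_upset (A : hyperspace a) : upset R A.
Proof.
have cA := hyperspace_closed (h := A).
by apply/(closed_increasingP cdV dirV cX ka cR cA)/hyperspace_increasing.
Qed.

Lemma cvg_hyperspace (F : set_system (hyperspace a)) (A : hyperspace a) :
  Filter F ->
  (forall U, open U -> upset (flip_rel R) U -> hit a U A -> F (hit a U)) ->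
  (forall W, open W -> upset R W -> miss a W A -> F (miss a W)) ->
  F --> A.
Proof.
move=> FF FU FW N [B [[D' sD' <-]] [C D'C CA]] sN.
apply: filterS sN _; apply: (@filterS _ F _ C) => [E CE|]; first by exists C.
have [fs sfs CE] := sD' _ D'C; rewrite -CE; apply: filter_bigI => i /[dup] ii.
move=> /sfs; rewrite inE; move: CA; rewrite -CE => /(_ i ii) iA.
case=> -[S [oS cS]] ES; rewrite -ES in iA *.
  by apply: FU => //; apply/co_increasingP.
by apply: FW => //; apply/co_decreasingP.
Qed.

Lemma open_hit U : open U -> upset (flip_rel R) U -> open (hit a U).
Proof.
move=> oU uU; exists [set hit a U]; last by rewrite bigcup_set1.
move=> _ ->; apply: finI_from1; left; exists U => //; split=> //.
exact/co_increasingP.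
Qed.

Lemma open_miss W : open W -> upset R W -> open (miss a W).
Proof.
move=> oW uW; exists [set miss a W]; last by rewrite bigcup_set1.
move=> _ ->; apply: finI_from1; right; exists W => //; split=> //.
exact/co_decreasingP.
Qed.

(** The limit, in the hit-and-miss topology, of an ultrafilter of closed
    increasing sets. *)
Definition hit_limit (F : set_system (hyperspace a)) : set X :=
  [set x | forall U, open U -> upset (flip_rel R) U -> U x -> F (hit a U)].

Lemma closed_hit_limit F : closed (hit_limit F).
Proof.
move=> x clx U oU uU Ux.
have /clx[y [Fy Uy]] : nbhs x U by exact: open_nbhs_nbhs.
exact: Fy.
Qed.

Lemma increasing_hit_limit F : increasing a (hit_limit F).
Proof.
apply/(closed_increasingP cdV dirV cX ka cR (@closed_hit_limit F)).
by move=> x y Fx Rxy U oU uU Uy; apply: Fx => //; exact: (uU y).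
Qed.

Definition hyperspace_lim (F : set_system (hyperspace a)) : hyperspace a :=
  Hyperspace (@closed_hit_limit F) (@increasing_hit_limit F).

(** Convergence along hit sets holds by construction.  If a miss set [miss a W]
    around the limit were not in [F], then [F]-almost every set would have a
    point outside [W]; a cluster point of these points, taken along [F], is
    outside [W] and yet belongs to the limit. *)
Lemma cvg_hyperspace_lim (F : set_system (hyperspace a)) :
  UltraFilter F -> F --> hyperspace_lim F.
Proof.
move=> FU; have FP : ProperFilter F by exact: ultra_proper.
apply: cvg_hyperspace => [U oU uU [x [Fx Ux]]|W oW uW limW]; first exact: Fx.
have [//|FnW] := in_ultra_setVsetC (miss a W) FU.
(* The sets [E S] for [S] in [F] generate a filter of subsets of the
   complement of [W]. *)
pose E (S : set (hyperspace a)) :=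
  [set x | ~ W x /\ exists2 A, S A & (A : set X) x].
have EP : ProperFilter (filter_from F E).
  apply: filter_from_proper; last first.
    move=> S FS; have [A [nWA SA]] := filter_ex (filterI FnW FS).
    have [x /not_implyP[Ax nWx]] : exists x, ~ ((A : set X) x -> W x).
      by apply/existsNP => AW; apply: nWA.
    by exists x; split=> //; exists A.
  apply: filter_from_filter; first by exists setT; exact: filterT.
  move=> S T FS FT; exists (S `&` T); first exact: filterI.
  by move=> x [nWx [A [SA TA] Ax]]; split; split=> //; exists A.
have FE S : F S -> filter_from F E (E S) by move=> FS; exists S.
have [//|x [_ Ex]] := cX EP; first exact: filterT.
have nWx : ~ W x.
  move=> Wx; have [|y [[nWy _] Wy]] := Ex _ W (FE _ FnW); last exact: nWy.
  exact: open_nbhs_nbhs.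
(* Were [hit a U] not in [F], the neighbourhood [U] of [x] would still meet
   [E (~` hit a U)], which is impossible. *)
exfalso; apply/nWx/limW => U oU uU Ux.
have [//|FnU] := in_ultra_setVsetC (hit a U) FU.
have [|y [[_ [A nUA Ay]] Uy]] := Ex _ U (FE _ FnU); first exact: open_nbhs_nbhs.
by exfalso; apply: nUA; exists y.
Qed.

Lemma compact_hyperspace : compact [set: hyperspace a].
Proof.
rewrite compact_ultra => F FU _.
by exists (hyperspace_lim F); split=> //; exact: cvg_hyperspace_lim.
Qed.

(** The down-closure of [x] is closed, and disjoint from the up-set [B]. *)
Lemma hyperspace_sep (A B : hyperspace a) x : (A : set X) x -> ~ (B : set X) x ->
  exists S T : set (hyperspace a),
    [/\ open S, open T, S A, T B & S `&` T = set0].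
Proof.
move=> Ax nBx.
have [|||||||U [W [[oU uU] [oW uW] BU xW UW0]]] :=
  @nachbin_separation _ cX hX R B (rel_image (flip_rel R) [set x]) (@cR qunit).
- exact: ka.
- by move=> y z t; exact: level_lower.
- exact: hyperspace_closed.
- exact: hyperspace_upset.
- apply: closed_rel_image => //; first exact: (closed_flip_rel (@cR _)).
  exact/accessible_closed_set1/hausdorff_accessible.
- move=> y z [_ -> Ryx] Rzy; exists x => //; exact: level_lower Ryx.
- apply/seteqP; split=> y // -[By [_ -> Ryx]]; apply: nBx.
  exact: hyperspace_upset By Ryx.
exists (hit a W), (miss a U); split=> //.
- exact: open_hit.
- exact: open_miss.
- by exists x; split=> //; apply: xW; exists x => //; exact: ka.
- apply/seteqP; split=> C // -[[y [Cy Wy]] CU].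
  by have : (U `&` W) y; [split=> //; exact: CU|rewrite UW0].
Qed.

Lemma hyperspace_eq (A B : hyperspace a) : (A : set X) = B -> A = B.
Proof.
case: A B => [A cA iA] [B cB iB] /= AB; case: _ / AB in cB iB *.
by congr Hyperspace; exact: Prop_irrelevance.
Qed.

Lemma hausdorff_hyperspace : hausdorff_space (hyperspace a).
Proof.
move=> A B AB; apply: hyperspace_eq; apply: contrapT => neAB.
have meet (S T : set (hyperspace a)) :
    open S -> open T -> S A -> T B -> S `&` T !=set0.
  by move=> oS oT SA TB; apply: AB; exact: open_nbhs_nbhs.
apply: neAB; apply/seteqP; split=> x hx; apply: contrapT => nx.
- have [S [T [oS oT SA TB ST0]]] := hyperspace_sep hx nx.
  by have := meet S T oS oT SA TB; rewrite ST0 => -[].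
- have [S [T [oS oT SB TA ST0]]] := hyperspace_sep hx nx.
  by have := meet T S oT oS TA SB; rewrite setIC ST0 => -[].
Qed.

Lemma vcategory_hausdorff_dist : vcategory (hausdorff_dist a).
Proof.
split=> [A|A B C].
  apply: le_qinf => _ [y Ay <-]; apply: le_trans (ka y) _.
  by apply: qsup_ub; exists y.
apply: le_qinf => _ [z Cz <-].
have distle (E F : hyperspace a) t : (F : set X) t ->
    hausdorff_dist a E F <= qsup [set a x t | x in (E : set X)].
  by move=> Ft; apply: qinf_lb; exists t.
apply: le_trans (qtens_le2l _ (distle B C z Cz)) _.
rewrite qtens_sup; apply: qsup_le => _ [_ [y By <-] <-].
apply: le_trans (qtens_le2 (distle A B y By) (lexx _)) _.
rewrite qtensC qtens_sup; apply: qsup_le => _ [_ [x Ax <-] <-].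
rewrite qtensC; apply: le_trans (ta x y z) _.
by apply: qsup_ub; exists x.
Qed.

(** Two successive approximations from totally below, [v] below [u] below the
    [xi]-value, are used: [u] passes from [xi] to almost all pairs [(A', B')],
    and [v] then extracts from the supremum defining their distance an actual
    point of [A']. *)
Lemma vfunctor_hyperspace (alpha : ultra (hyperspace a) -> hyperspace a) :
  convergence_map alpha ->
  vfunctor (ultra_dist (hausdorff_dist a)) (hausdorff_dist a) alpha.
Proof.
move=> calpha F G; apply: qsup_le => _ [w [wF wG] <-].
set A := alpha F; set B := alpha G.
have wU := ultra_filter w.
have wP : ProperFilter w by exact: ultra_proper.
apply: le_qinf => _ [y By <-].
apply: le_totally_below => // u tu.
(* Otherwise the complementary set of pairs is in [w], and [u], being totally
   below the supremum of the distances over it, is below one of them. *)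
have wu : ultra_sets w [set p | u <= hausdorff_dist a p.1 p.2].
  have [//|nwu] := in_ultra_setVsetC [set p | u <= hausdorff_dist a p.1 p.2] wU.
  have [|_ [p np <-] up //] := tu [set hausdorff_dist a p.1 p.2 | p in
    ~` [set p | u <= hausdorff_dist a p.1 p.2]].
  apply: qinf_lb; eexists; last reflexivity.
  by apply: filterS nwu => p np; exists p.
apply: le_totally_below => // v tv.
apply: contrapT => nv.
(* [K] is the closed down-set of all [x] with [v <= a x y]. *)
pose K := rel_image (flip_rel (level a v)) [set y].
have [|||||||U [W [[oU uU] [oW uW] AU KW UW0]]] :=
  @nachbin_separation _ cX hX R A K (@cR qunit).
- exact: ka.
- by move=> ? ? ?; exact: level_lower.
- exact: hyperspace_closed.
- exact: hyperspace_upset.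
- apply: closed_rel_image => //; first exact: (closed_flip_rel (@cR _)).
  exact/accessible_closed_set1/hausdorff_accessible.
- move=> x z [_ -> vxy] Rzx; exists y => //; exact: level_lower vxy.
- apply/seteqP; split=> x // -[Ax [_ -> vxy]]; apply: nv.
  by apply: le_trans vxy _; apply: qsup_ub; exists x.
(* [T] is the closed up-set of the points at level [v] from some point outside
   [W]; as [W] contains [K], the point [y] is not in [T]. *)
pose T := rel_image (level a v) (~` W).
have cT : closed T by apply: closed_rel_image => //; exact: open_closedC.
have wA : ultra_sets w (fst @^-1` miss a U).
  have : ultra_sets F (miss a U).
    by apply: (calpha F); apply: open_nbhs_nbhs; split=> //; exact: open_miss.
  by rewrite -wF.
have wB : ultra_sets w (snd @^-1` hit a (~` T)).
  have : ultra_sets G (hit a (~` T)).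
    apply: (calpha G); apply: open_nbhs_nbhs; split.
      apply: open_hit; first exact: closed_openC.
      apply: upset_setC => z t [x nWx vxz] Rzt.
      exists x => //; exact: level_upper vxz Rzt.
    exists y; split=> // -[x nWx vxy]; apply/nWx/KW.
    by exists y.
  by rewrite -wG.
have [[A' B'] [[/= up A'U] [z [B'z nTz]]]] := filter_ex (filterI (filterI wu wA) wB).
have [|_ [x A'x <-] vxz] := tv [set a x z | x in (A' : set X)].
  by apply: le_trans up _; apply: qinf_lb; exists z.
apply: nTz; exists x => // Wx.
by have : (U `&` W) x; [split=> //; exact: A'U|rewrite UW0].
Qed.

End Hyperspace.

Theorem proposition4p18 (d : Order.disp_t) (V : quantaleType d)
    (cdV : completely_distributive V)
    (dirV : directed [set u : V | totally_below u qunit])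
    (X : topologicalType) (a : X -> X -> V) :
  vcat_compact_hausdorff a ->
  vcat_compact_hausdorff (hausdorff_dist a).
Proof.
move=> aX; have cH := compact_hyperspace cdV dirV aX.
split=> //; [exact: vcategory_hausdorff_dist|exact: hausdorff_hyperspace|].
have [alpha calpha] := convergence_map_exists cH.
by exists alpha => //; exact: vfunctor_hyperspace.
Qed.
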